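(* Let $T$ be an infinite Hausdorff topological space whose isolated points are dense in $T$, and let $\Gamma$ be an infinite set. Let $X$ be one of the following Banach spaces: (a) $C(T)$, where $T$ is compact; (b) $C_0(T)$, where $T$ is locally compact; (c) $\ell_\infty(\Gamma)$ or $c_0(\Gamma)$. Then $X$ has no countable star-finite covering by closed balls.
   Context: All spaces are real and equipped with the supremum norm. $C(T)$ is the space of continuous real functions on the compact space $T$; $C_0(T)$ is the space of bounded continuous real functions on the locally compact space $T$ that vanish at infinity; $\ell_\infty(\Gamma)$ is the space of bounded real functions on $\Gamma$, and $c_0(\Gamma)$ its subspace of functions vanishing at infinity. Closed balls have positive radius. A covering of $X$ is a family of nonempty subsets of $X$ whose union is $X$. A family of sets is star-finite if each of its members intersects only finitely many other members. *)

(* Defs.v *)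
From HB Require Import structures.
From mathcomp Require Import all_boot all_order all_algebra.
From mathcomp Require Import ring lra.
From mathcomp Require Import all_classical all_reals all_analysis.

Set Implicit Arguments.
Unset Strict Implicit.
Unset Printing Implicit Defensive.

Import Order.TTheory GRing.Theory Num.Theory.
Import numFieldNormedType.Exports.

Local Open Scope classical_set_scope.
Local Open Scope ring_scope.

Section Coverings.
Context {K : numFieldType} {X : normedModType K}.
Implicit Type F : set (set X).

Definition covering F :=
  (forall B, F B -> B !=set0) /\ \bigcup_(B in F) B = [set: X].

Definition star_finite F :=
  forall A, F A -> finite_set [set B | [/\ F B, B <> A & A `&` B !=set0]].

Definition closed_ball_family F :=
  forall B, F B -> exists (c : X) (r : K), 0 < r /\ B = closed_ball c r.

End Coverings.

(* [countable] includes finite. *)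
Definition has_countable_star_finite_ball_covering
    (K : numFieldType) (X : normedModType K) :=
  exists F : set (set X),
    [/\ countable F, covering F, star_finite F & closed_ball_family F].

Definition uniform_adherent (R : realType) (T : Type) (S : set (T -> R)) f :=
  forall e, 0 < e -> exists2 g, S g & forall t, `|f t - g t| <= e.

(* Uniformly closed linear subspaces of the bounded functions T -> R: each of
   them is a Banach space for the supremum norm. *)
Record supSubspace (R : realType) (T : Type) := SupSubspace {
  ss_set : set (T -> R);
  ss_bounded : forall f, ss_set f -> bounded_fun f;
  ss_set0 : ss_set 0;
  ss_setD : forall a f g, ss_set f -> ss_set g -> ss_set (a *: f + g);
  ss_closed : forall f, uniform_adherent ss_set f -> ss_set f }.

Definition ss_pred (R : realType) (T : Type) (E : supSubspace R T) :
  {pred T -> R} := fun f => f \in ss_set E.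

Lemma ss_submod (R : realType) (T : Type) (E : supSubspace R T) :
  submod_closed (ss_pred E).
Proof.
split=> [|a f g]; rewrite !unfold_in /ss_pred !inE; first exact: ss_set0.
exact: ss_setD.
Qed.

HB.instance Definition _ (R : realType) (T : Type) (E : supSubspace R T) :=
  GRing.isSubmodClosed.Build R (T -> R) (ss_pred E) (ss_submod E).

Record ss_type (R : realType) (T : Type) (E : supSubspace R T) := SSFun {
  ss_fun :> T -> R;
  ss_funP : ss_fun \in ss_pred E }.

HB.instance Definition _ (R : realType) (T : Type) (E : supSubspace R T) :=
  [isSub for @ss_fun R T E].
HB.instance Definition _ (R : realType) (T : Type) (E : supSubspace R T) :=
  [Choice of ss_type E by <:].
HB.instance Definition _ (R : realType) (T : Type) (E : supSubspace R T) :=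
  [SubChoice_isSubLmodule of ss_type E by <:].

Section SupNorm.
Context {R : realType} {T : Type} {E : supSubspace R T}.
Implicit Types f g : ss_type E.

(* On the empty type the set is empty and its supremum is 0. *)
Definition sup_norm f : R := sup [set `|f t| | t in [set: T]].

Lemma ss_fun_in f : ss_set E f.
Proof. exact: set_mem (ss_funP f). Qed.

Lemma has_ubound_norm f : has_ubound [set `|f t| | t in [set: T]].
Proof.
have [M [_ HM]] := ss_bounded (ss_fun_in f).
exists (M + 1) => _ [t _ <-].
by apply: (HM (M + 1)) => //; rewrite ltrDl.
Qed.

Lemma le_sup_norm f t : `|f t| <= sup_norm f.
Proof. by apply: ub_le_sup; [exact: has_ubound_norm | exists t]. Qed.

Lemma sup_norm_le f (e : R) :
  0 <= e -> (forall t, `|f t| <= e) -> sup_norm f <= e.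
Proof.
move=> e0 fe; rewrite /sup_norm.
have [->|N0] := eqVneq [set `|f t| | t in [set: T]] set0; first by rewrite sup0.
by apply: ge_sup; [exact/set0P | move=> _ [t _ <-]].
Qed.

Lemma sup_norm_ge0 f : 0 <= sup_norm f.
Proof.
have [[t _]|N] := pselect (exists _ : T, True).
  by apply: le_trans (le_sup_norm f t).
rewrite /sup_norm (_ : [set _ | _ in _] = set0) ?sup0//.
by apply/seteqP; split=> // x [t _ _]; apply: N; exists t.
Qed.

Lemma ler_sup_normD f g : sup_norm (f + g) <= sup_norm f + sup_norm g.
Proof.
apply: sup_norm_le => [|t]; first by rewrite addr_ge0 ?sup_norm_ge0.
by rewrite (le_trans (ler_normD _ _))// lerD ?le_sup_norm.
Qed.

Lemma sup_normZ_le (a : R) f : sup_norm (a *: f) <= `|a| * sup_norm f.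
Proof.
apply: sup_norm_le => [|t]; first by rewrite mulr_ge0 ?sup_norm_ge0.
by rewrite normrM ler_wpM2l ?le_sup_norm.
Qed.

Lemma sup_normZ (a : R) f : sup_norm (a *: f) = `|a| * sup_norm f.
Proof.
apply/eqP; rewrite eq_le sup_normZ_le /=.
have [->|a0] := eqVneq a 0; first by rewrite normr0 mul0r sup_norm_ge0.
rewrite -ler_pdivlMl ?normr_gt0// -normfV.
by apply: le_trans (sup_normZ_le _ _); rewrite scalerA mulVf// scale1r.
Qed.

Lemma sup_norm0_eq0 f : sup_norm f = 0 -> f = 0.
Proof.
move=> f0; apply/val_inj/funext => t /=; apply/eqP.
by rewrite -normr_le0 -f0 le_sup_norm.
Qed.

HB.instance Definition _ := Lmodule_isNormed.Build R (ss_type E)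
  ler_sup_normD sup_normZ sup_norm0_eq0.

Lemma normE f : `|f| = sup_norm f.
Proof. by []. Qed.

Lemma ss_cauchy_cvg (F : set_system (ss_type E)) :
  ProperFilter F -> cauchy F -> cvg F.
Proof.
move=> FF Fc.
have half_lt (e : R) : 0 < e -> e / 2 < e by lra.
have Fball (e : R) : 0 < e ->
    exists h : ss_type E, F [set f | forall t, `|f t - h t| <= e].
  move=> e0; have /cauchyP /(_ e e0) [h Fh] := Fc.
  exists h; apply: filterS Fh => f; rewrite -ball_normE /= distrC => hf t.
  exact: le_trans (le_sup_norm (f - h) t) (ltW hf).
pose l t : R := lim ((fun f : ss_type E => f t) @ F).
have cvl t : (fun f : ss_type E => f t) @ F --> l t.
  apply: (@cauchy_cvg R); apply: cauchy_exP => e e0.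
  have [h Fh] := Fball (e / 2) (divr_gt0 e0 (ltr0n _ 2)).
  exists (h t); suff : F [set f | ball (h t) e (f t)] by [].
  apply: filterS Fh => f hf.
  rewrite -ball_normE /= distrC; apply: (le_lt_trans (hf t)).
  exact: half_lt.
have Fl (e : R) : 0 < e -> F [set f | forall t, `|l t - f t| <= e].
  move=> e0; have e20 : 0 < e / 2 by rewrite divr_gt0.
  have [h Fh] := Fball _ e20.
  apply: filterS (Fh) => f hf t.
  rewrite [e]splitr -(subrK (h t) (l t)) -addrA.
  rewrite (le_trans (ler_normD _ _))// lerD//; last by rewrite distrC.
  apply/ler_addgt0Pl => d d0.
  have Fd : F [set g | `|l t - g t| <= d].
    by move/cvgrPdist_le : (cvl t); exact.
  have [g [gd gh]] := filter_ex (filterI Fd Fh).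
  rewrite -(subrK (g t) (l t)) -addrA.
  by rewrite (le_trans (ler_normD _ _))// lerD.
have lE : l \in ss_pred E.
  rewrite unfold_in /ss_pred inE; apply: ss_closed => e e0.
  have [g gl] := filter_ex (Fl e e0).
  by exists g => //; exact: ss_fun_in.
apply/cvg_ex; exists (SSFun lE); apply/cvgrPdist_le => /= e e0.
apply: filterS (Fl e e0) => f lf.
by rewrite normE; apply: sup_norm_le; [exact: ltW | exact: lf].
Qed.

HB.instance Definition _ := Uniform_isComplete.Build (ss_type E) ss_cauchy_cvg.

End SupNorm.

Section Spaces.
Context (R : realType).

Section Bounded.
Context {T : Type}.
Implicit Types f g : T -> R.

Lemma bounded_funPex f :
  bounded_fun f <-> exists M, forall t, `|f t| <= M.
Proof.
split=> [[M [_ HM]]|[M HM]].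
  by exists (M + 1) => t; apply: (HM (M + 1)); rewrite ?ltrDl.
exists M; split=> [|x Mx t _]; first exact: num_real.
exact: le_trans (HM t) (ltW Mx).
Qed.

Lemma bounded_fun0 : bounded_fun (0 : T -> R).
Proof. by apply/bounded_funPex; exists 0 => t; rewrite normr0. Qed.

Lemma bounded_funDZ a f g :
  bounded_fun f -> bounded_fun g -> bounded_fun (a *: f + g).
Proof.
move=> /bounded_funPex[M fM] /bounded_funPex[N gN]; apply/bounded_funPex.
exists (`|a| * M + N) => t; rewrite (le_trans (ler_normD _ _))// lerD//.
by rewrite normrM ler_wpM2l.
Qed.

Lemma uniform_adherentS (S S' : set (T -> R)) f :
  S `<=` S' -> uniform_adherent S f -> uniform_adherent S' f.
Proof. by move=> SS' Sf e /Sf[g /SS' Sg fg]; exists g. Qed.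

Lemma bounded_fun_closed f :
  uniform_adherent bounded_fun f -> bounded_fun f.
Proof.
move=> /(_ 1 ltr01)[g /bounded_funPex[M gM] fg]; apply/bounded_funPex.
exists (1 + M) => t; rewrite -(subrK (g t) (f t)).
by rewrite (le_trans (ler_normD _ _))// lerD.
Qed.

End Bounded.

Section Continuous.
Context {T : topologicalType}.
Implicit Types f g : T -> R.

Lemma continuousDZ a f g :
  continuous f -> continuous g -> continuous (a *: f + g).
Proof. by move=> cf cg t; apply: cvgD; [apply: cvgZr; exact: cf | exact: cg]. Qed.

Lemma continuous_closed f :
  uniform_adherent [set g : T -> R | continuous g] f -> continuous f.
Proof.
move=> fS t; apply/cvgrPdist_le => e e0.
have e30 : 0 < e / 3 by rewrite divr_gt0.
have [g cg fg] := fS _ e30.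
have gt : \forall s \near t, `|g t - g s| <= e / 3.
  by move/cvgrPdist_le : (cg t); exact.
apply: filterS gt => s gs.
have -> : f t - f s = (f t - g t) + (g t - g s) + (g s - f s).
  by ring.
have -> : e = e / 3 + e / 3 + e / 3 by field.
rewrite (le_trans (ler_normD _ _))// lerD ?(distrC (g s))//.
by rewrite (le_trans (ler_normD _ _))// lerD.
Qed.

Lemma continuous_bounded f :
  compact [set: T] -> continuous f -> bounded_fun f.
Proof.
move=> cT cf; apply/bounded_funPex.
have /compact_bounded[M [_ HM]] : compact (f @` [set: T]).
  by apply: continuous_compact => //; exact: continuous_subspaceT.
by exists (M + 1) => t; apply: (HM (M + 1)); rewrite ?ltrDl//; exists t.
Qed.

Lemma closed_norm_ge f e : continuous f -> closed [set t | e <= `|f t|].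
Proof.
move=> cf; rewrite (_ : mkset _ = (fun t => `|f t|) @^-1` [set x | e <= x])//.
apply: preimage_closed; last exact: closed_ge.
by move=> t _; apply: cvg_norm; exact: cf.
Qed.

Definition vanishes_at_infinity f :=
  forall e, 0 < e -> compact [set t | e <= `|f t|].

End Continuous.

(* Vanishing at infinity on the discrete space T, whose compact sets are the
   finite ones. *)
Definition vanishes_at_infinity_discrete (T : Type) (f : T -> R) :=
  forall e, 0 < e -> finite_set [set t | e <= `|f t|].

Section NormGe.
Context {T : Type}.
Implicit Types f g : T -> R.

Lemma norm_geDZ_sub (e a : R) f g : 0 < e ->
  [set t | e <= `|(a *: f + g) t|] `<=`
  [set t | e / 2 / (`|a| + 1) <= `|f t|] `|` [set t | e / 2 <= `|g t|].
Proof.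
move=> e0 t /= et; apply/orP; rewrite -implyNb -ltNge; apply/implyP => ft.
rewrite leNgt; apply/negP => gt; move: et; apply/negP; rewrite -ltNge.
rewrite (le_lt_trans (ler_normD _ _))// [ltRHS]splitr ler_ltD//.
have a1 : 0 < `|a| + 1 by rewrite ltr_wpDl.
move: ft; rewrite ltr_pdivlMr// => /ltW; apply: le_trans.
by rewrite normrM mulrC ler_wpM2l// lerDl.
Qed.

Lemma norm_ge_adherent_sub (e : R) f g : 0 < e ->
  (forall t, `|f t - g t| <= e / 2) ->
  [set t | e <= `|f t|] `<=` [set t | e / 2 <= `|g t|].
Proof.
move=> e0 fg t /= et; rewrite -(lerD2l (e / 2)) -splitr (le_trans et)//.
by rewrite -{1}(subrK (g t) (f t)) (le_trans (ler_normD _ _))// lerD2r.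
Qed.

Lemma norm_ge0_fun (e : R) : 0 < e -> [set t | e <= `|(0 : T -> R) t|] = set0.
Proof.
by move=> e0; apply/seteqP; split=> // t /=; rewrite normr0 leNgt e0.
Qed.

End NormGe.

Program Definition C_space (T : topologicalType) (cT : compact [set: T]) :
    supSubspace R T := @SupSubspace R T [set f | continuous f] _ _ _ _.
Next Obligation. by move=> T cT f; exact: continuous_bounded. Qed.
Next Obligation. by move=> T cT t; exact: cvg_cst. Qed.
Next Obligation. by move=> T cT a f g; exact: continuousDZ. Qed.
Next Obligation. by move=> T cT f; exact: continuous_closed. Qed.

Program Definition C0_space (T : topologicalType) : supSubspace R T :=
  @SupSubspace R T
    [set f | [/\ bounded_fun f, continuous f & vanishes_at_infinity f]]
    _ _ _ _.
Next Obligation. by move=> T f []. Qed.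
Next Obligation.
move=> T; split=> [|t|e e0]; first exact: bounded_fun0; first exact: cvg_cst.
by rewrite norm_ge0_fun//; exact: compact0.
Qed.
Next Obligation.
move=> T a f g [bf cf vf] [bg cg vg].
have cfg := continuousDZ (a := a) cf cg.
split=> [||e e0] //; first exact: bounded_funDZ.
apply: (subclosed_compact _ _ (norm_geDZ_sub e0)); first exact: closed_norm_ge.
have a1 : 0 < `|a| + 1 by rewrite ltr_wpDl.
by apply: compactU; [apply: vf | apply: vg]; rewrite ?divr_gt0.
Qed.
Next Obligation.
move=> T f fS.
have cf : continuous f.
  by apply: continuous_closed; apply: uniform_adherentS fS => g [].
split=> // [|e e0].
  by apply: bounded_fun_closed; apply: uniform_adherentS fS => g [].
have e20 : 0 < e / 2 by rewrite divr_gt0.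
have [g [_ _ vg] fg] := fS _ e20.
apply: (subclosed_compact _ (vg _ e20) (norm_ge_adherent_sub e0 fg)).
exact: closed_norm_ge.
Qed.

Program Definition linfty_space (T : Type) : supSubspace R T :=
  @SupSubspace R T bounded_fun _ _ _ _.
Next Obligation. by []. Qed.
Next Obligation. by move=> T; exact: bounded_fun0. Qed.
Next Obligation. by move=> T a f g; exact: bounded_funDZ. Qed.
Next Obligation. by move=> T f; exact: bounded_fun_closed. Qed.

Program Definition c0_space (T : Type) : supSubspace R T :=
  @SupSubspace R T
    [set f | bounded_fun f /\ vanishes_at_infinity_discrete f] _ _ _ _.
Next Obligation. by move=> T f []. Qed.
Next Obligation.
move=> T; split=> [|e e0]; first exact: bounded_fun0.
by rewrite norm_ge0_fun.
Qed.
Next Obligation.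
move=> T a f g [bf vf] [bg vg]; split=> [|e e0]; first exact: bounded_funDZ.
apply: (sub_finite_set (norm_geDZ_sub e0)); rewrite finite_setU.
have a1 : 0 < `|a| + 1 by rewrite ltr_wpDl.
by split; [apply: vf | apply: vg]; rewrite ?divr_gt0.
Qed.
Next Obligation.
move=> T f fS; split=> [|e e0].
  by apply: bounded_fun_closed; apply: uniform_adherentS fS => g [].
have e20 : 0 < e / 2 by rewrite divr_gt0.
have [g [_ vg] fg] := fS _ e20.
exact: sub_finite_set (norm_ge_adherent_sub e0 fg) (vg _ e20).
Qed.

End Spaces.

Arguments C_space R {T} cT.

Coercion ss_type : supSubspace >-> Sortclass.

(* Main.v *)
Require Import Defs.
From mathcomp Require Import all_boot all_order all_algebra.
From mathcomp Require Import lra.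
From mathcomp Require Import all_classical all_reals all_analysis.

Set Implicit Arguments.
Unset Strict Implicit.
Unset Printing Implicit Defensive.

Import Order.TTheory GRing.Theory Num.Theory.
Import numFieldNormedType.Exports.

Local Open Scope classical_set_scope.
Local Open Scope ring_scope.

(** In each of these spaces a closed ball is a box: membership in the ball of
    center c and radius r is decided by infinitely many scalar conditions
    |c(j) - x(j)| <= r, one for each isolated point (or index) j, and any single
    coordinate of a vector can be changed at will. The proof only uses this and
    completeness.

    Let F be a countable star-finite covering by balls, and call a point crowded
    when each of its neighbourhoods meets infinitely many members of F. By
    Baire's argument run on the crowded points ([no_countable_star_finite_cover])
    it is enough to prove that crowded points exist ([crowded_nonempty]) and that
    near a crowded point no single member B contains all crowded points
    ([crowded_not_in_member]).

    Both rest on one device. Let U be a box and G a minimal subfamily of F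
    covering U; it exists because F is point-finite, and each C in G has a point
    y in U lying in no other member of G. Each of the finitely many neighbours of
    C misses y because of one coordinate. Move y along any other coordinate u:
    the neighbours are never entered, so if y can leave C inside U, then new
    members of G, all disjoint from C, have to pile up at the exit point
    ([coordinate_unconstrained]). Suppose now that nothing piles up at points of
    C inside U. Then C does not restrict the coordinate u over U, and its radius
    is at least that of U ([rad_ge_of_not_crowded]).

    If no point is crowded, a box U of very large radius contradicts this. If
    near a crowded point x0 all crowded points lie in B, take U around x0 smaller
    than the finitely many members meeting B; the others carry no crowded point
    in U, so all members of G are at least as large as U. An interval no shorter
    than another one and meeting it contains one of its ends. Hence the members
    of G meeting a slab, obtained by letting finitely many coordinates vary in U,
    are finitely many ([touching_slab]): each of them contains a corner. Nothing
    piles up along a line any more, so every member of G is described in U by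
    finitely many coordinates. The finitely many members of G through x0 thus
    depend on finitely many coordinates, and by finiteness in slabs they cover a
    neighbourhood of x0. By star-finiteness x0 is not crowded
    ([not_crowded_of_large]). *)

(** * Finite families and minimal subcovers *)

Lemma finite_set_uniform_radius (R : realType) (I : choiceType) (K : set I)
    (P : I -> R -> Prop) :
  finite_set K ->
  (forall i e e', P i e -> e' <= e -> P i e') ->
  (forall i, K i -> exists2 e, 0 < e & P i e) ->
  exists2 e, 0 < e & forall i, K i -> P i e.
Proof.
move=> /finite_seqP[s ->] Pmono Ks.
have {Ks} : forall i, i \in s -> exists2 e, 0 < e & P i e by [].
elim: s => [|i s IHs] Ps; first by exists 1.
have [|e e0 Pe] := IHs; first by move=> k ks; apply: Ps; rewrite in_cons ks orbT.
have [d d0 Pd] := Ps i (mem_head _ _).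
exists (Num.min d e); first by rewrite lt_min d0.
move=> k /=; rewrite in_cons => /predU1P[->|ks].
  by apply: Pmono Pd _; rewrite ge_min lexx.
by apply: Pmono (Pe k ks) _; rewrite ge_min lexx orbT.
Qed.

Lemma finite_set_uniform_seq (I J : choiceType) (K : set I)
    (P : I -> J -> Prop) :
  finite_set K -> (forall i, K i -> exists j, P i j) ->
  exists s : seq J, forall i, K i -> exists2 j, j \in s & P i j.
Proof.
move=> /finite_seqP[l ->] Kl.
have {Kl} : forall i, i \in l -> exists j, P i j by [].
elim: l => [|i l IHl] Pl; first by exists [::].
have [|s Ps] := IHl; first by move=> k kl; apply: Pl; rewrite in_cons kl orbT.
have [j Pij] := Pl i (mem_head _ _).
exists (j :: s) => k /=; rewrite in_cons => /predU1P[->|kl].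
  by exists j => //; exact: mem_head.
by have [j' j's Pj'] := Ps k kl; exists j' => //; rewrite in_cons j's orbT.
Qed.

Lemma chain_finite_subset (I : choiceType) (C : set (set I)) (K : set I) :
  total_on C subset -> finite_set K -> C !=set0 ->
  K `<=` \bigcup_(H in C) H -> exists2 H, C H & K `<=` H.
Proof.
move=> Ctot /finite_seqP[s ->] [H0 CH0].
elim: s => [|i s IHs] sC; first by exists H0.
have [|H CH sH] := IHs.
  by move=> k /= ks; apply: sC => /=; rewrite in_cons ks orbT.
have [H' CH' H'i] := sC i (mem_head _ _).
have [HH'|H'H] := Ctot _ _ CH CH'.
  by exists H' => // k /=; rewrite in_cons => /predU1P[->//|/sH/HH'].
by exists H => // k /=; rewrite in_cons => /predU1P[->|/sH//]; exact: H'H.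
Qed.

(** Zorn's lemma applied to the removable subfamilies. The union of a chain of
    removable subfamilies is removable because only finitely many members pass
    through a given point: if they all were in the union, they would already be
    in one element of the chain. *)
Lemma minimal_subcover (T : choiceType) (F : set (set T)) (U : set T) :
  (forall x, finite_set [set A | F A /\ A x]) ->
  U `<=` \bigcup_(A in F) A ->
  exists G, [/\ G `<=` F, U `<=` \bigcup_(A in G) A &
    forall C, G C -> exists y, [/\ U y, C y & forall A, G A -> A y -> A = C]].
Proof.
move=> Ffin FU.
pose P (H : set (set T)) := U `<=` \bigcup_(A in F `\` H) A.
have [H [PH Hmax]] : exists H, P H /\ forall H', H `<` H' -> ~ P H'.
  apply: Zorn_bigcup => C CP Ctot x Ux.
  have [C0|/set0P C0] := eqVneq C set0.
    have [A FA Ax] := FU x Ux; exists A => //; split=> //.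
    by rewrite C0 bigcup_set0.
  apply: contrapT => Nx.
  have [|||H CH HK] := chain_finite_subset (K := [set A | F A /\ A x]) Ctot.
  - exact: Ffin.
  - exact: C0.
  - move=> A /= [FA Ax]; apply: contrapT => NA; apply: Nx; exists A => //.
  - by have [A [FA NHA] Ax] := CP _ CH x Ux; apply: NHA; apply: HK.
exists (F `\` H); split; [exact: subDsetl|exact: PH|].
move=> C [FC NHC]; apply: contrapT => Npriv.
apply: (Hmax (H `|` [set C])).
  split; first by move=> A HA; left.
  by move=> /(_ C (or_intror erefl)).
move=> x Ux; have [A [FA NHA] Ax] := PH x Ux.
apply: contrapT => NA; apply: Npriv; exists x.
have GC B : (F `\` H) B -> B x -> B = C.
  move=> [FB NHB] Bx; apply: contrapT => BC.
  by apply: NA; exists B => //; split=> // -[].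
by split=> //; rewrite -(GC A).
Qed.

(** The segment from y to v leaves the interval of center a and radius s at w.
    The points w' beyond w witness that w is an exit point. Being between y and
    v is expressed as membership in every interval that contains both. *)
Lemma segment_exit (R : realType) (a s y v : R) : `|a - y| <= s -> s < `|a - v| ->
  exists w, [/\ `|a - w| <= s,
    forall x h : R, `|x - y| <= h -> `|x - v| <= h -> `|x - w| <= h &
    forall e : R, 0 < e -> exists w', [/\ `|w - w'| <= e, s < `|a - w'| &
    forall x h : R, `|x - y| <= h -> `|x - v| <= h -> `|x - w'| <= h]].
Proof.
have between (x h w : R) : `|x - y| <= h -> `|x - v| <= h ->
    Num.min y v <= w <= Num.max y v -> `|x - w| <= h.
  rewrite !ler_norml => /andP[? ?] /andP[? ?] /andP[].
  by rewrite ge_min le_max => /orP[] ? /orP[] ?; apply/andP; split; lra.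
rewrite ler_norml ltr_normr => /andP[ya1 ya2] va.
have {va} [va|va] : v < a - s \/ a + s < v by case/orP: va; [left|right]; lra.
  have vy : v < y by lra.
  rewrite (min_r (ltW vy)) (max_l (ltW vy)) in between.
  exists (a - s); split=> [|x h xy xv|e e0].
  - by rewrite ler_norml; apply/andP; split; lra.
  - by apply: between => //; apply/andP; split; lra.
  exists (Num.max v (a - s - e)); split=> [||x h xy xv].
  - by rewrite ler_norml; have [?|?] := leP v (a - s - e); apply/andP; split; lra.
  - by rewrite ltr_normr; apply/orP; left; have [?|?] := leP v (a - s - e); lra.
  - by apply: between => //; have [?|?] := leP v (a - s - e); apply/andP; split; lra.
have yv : y < v by lra.
rewrite (min_l (ltW yv)) (max_r (ltW yv)) in between.
exists (a + s); split=> [|x h xy xv|e e0].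
- by rewrite ler_norml; apply/andP; split; lra.
- by apply: between => //; apply/andP; split; lra.
exists (Num.min v (a + s + e)); split=> [||x h xy xv].
- by rewrite ler_norml; have [?|?] := leP v (a + s + e); apply/andP; split; lra.
- by rewrite ltr_normr; apply/orP; right; have [?|?] := leP v (a + s + e); lra.
- by apply: between => //; have [?|?] := leP v (a + s + e); apply/andP; split; lra.
Qed.

(** * Families of boxes in spaces with coordinates *)
Section BoxSpace.
Context {R : realType} {X : completeNormedModType R} {J : choiceType}.
Context (co : J -> X -> R).
Context (norm_co : forall x y (e : R), 0 <= e ->
  (`|x - y| <= e <-> forall j, `|co j x - co j y| <= e)).
Context (update : forall x j (v : R), exists y,
  co j y = v /\ forall k, k != j -> co k y = co k x).
Context (J_infinite : infinite_set [set: J]).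

Definition box (c : X) (r : R) := [set x | forall j, `|co j c - co j x| <= r].

Lemma exists_fresh (s : seq J) : exists j, j \notin s.
Proof.
apply: contrapT => Ns; apply: J_infinite; apply: (@sub_finite_set _ _ [set` s]).
  by move=> j _ /=; apply/negPn/negP => js; apply: Ns; exists j.
exact: finite_seq.
Qed.

Lemma boxE c r : 0 < r -> closed_ball c r = box c r.
Proof.
move=> r0; rewrite closed_ballE//; apply/seteqP; split=> x /=;
  by move/(norm_co c x (ltW r0)).
Qed.

Lemma box_center c r : 0 <= r -> box c r c.
Proof. by move=> r0 j; rewrite subrr normr0. Qed.

Lemma sub_box c r r' : r <= r' -> box c r `<=` box c r'.
Proof. by move=> rr' x cx j; exact: le_trans (cx j) rr'. Qed.

(** Finite sets of coordinates may be prescribed freely, by iterating the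
    one-coordinate updates. *)
Lemma patch (s : seq J) x p : exists q,
  (forall j, j \in s -> co j q = co j p) /\
  (forall j, j \notin s -> co j q = co j x).
Proof.
elim: s => [|i s [q [qs qNs]]]; first by exists x.
have [y [yi yNi]] := update q i (co i p); exists y; split=> j.
  by rewrite in_cons; have [->//|ji] := eqVneq j i; rewrite yNi//; exact: qs.
by rewrite in_cons negb_or => /andP[ji js]; rewrite yNi// qNs.
Qed.

Context (F : set (set X)) (cen : set X -> X) (rad : set X -> R).
Context (rad_gt0 : forall A, F A -> 0 < rad A).
Context (FE : forall A, F A -> A = box (cen A) (rad A)).
Context (F_star : star_finite F).
Context (F_cover : forall x, exists2 A, F A & A x).
Context (F_countable : countable F).

Lemma mem_member A x : F A ->
  A x <-> forall j, `|co j (cen A) - co j x| <= rad A.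
Proof. by move=> FA; rewrite {1}(FE FA). Qed.

Lemma notin_member A x : F A -> ~ A x ->
  exists j, rad A < `|co j (cen A) - co j x|.
Proof.
move=> FA Ax; apply: contrapT => Nj; apply: Ax; apply/mem_member => // j.
by rewrite leNgt; apply/negP => Aj; apply: Nj; exists j.
Qed.

Definition touching (G : set (set X)) (V : set X) :=
  [set A | G A /\ A `&` V !=set0].

Lemma touching_sub G G' V V' : G `<=` G' -> V `<=` V' ->
  touching G V `<=` touching G' V'.
Proof.
move=> GG' VV' A [GA [x [Ax Vx]]]; split; first exact: GG'.
by exists x; split=> //; exact: VV'.
Qed.

(** Star-finiteness, in the form that counts B among its own neighbours. *)
Lemma touching_member B : F B -> finite_set (touching F B).
Proof.
move=> FB; apply: (@sub_finite_set _ _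
  ([set A | [/\ F A, A <> B & B `&` A !=set0]] `|` [set B])).
  move=> A [FA AB]; have [->|/eqP NAB] := eqVneq A B; first by right.
  by left; split=> //; rewrite setIC.
by rewrite finite_setU; split; [exact: F_star|exact: finite_set1].
Qed.

Lemma point_finite x : finite_set [set A | F A /\ A x].
Proof.
have [B FB Bx] := F_cover x.
by apply: sub_finite_set (touching_member FB) => A [FA Ax]; split=> //; exists x.
Qed.

Lemma member_separation A x : F A -> ~ A x ->
  exists2 e, 0 < e & forall z, box x e z -> ~ A z.
Proof.
move=> FA /(notin_member FA)[j Aj].
exists ((`|co j (cen A) - co j x| - rad A) / 2); first by lra.
move=> z /(_ j) xz /(mem_member z FA)/(_ j) Az.
have := ler_distD (co j z) (co j (cen A)) (co j x).
by rewrite (distrC (co j z)); lra.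
Qed.

(** If finitely many members meet V, each of those missing x stays at a positive
    distance from x, hence a small box around x excludes them from V. *)
Lemma touching_shrink G V x : G `<=` F -> finite_set (touching G V) ->
  exists2 e, 0 < e & forall A, G A -> A `&` (V `&` box x e) !=set0 -> A x.
Proof.
move=> GF Vfin.
have [i e e'|A [GA _]|e e0 He] := finite_set_uniform_radius
    (P := fun A e => A `&` (V `&` box x e) !=set0 -> A x) Vfin.
- move=> Pe ee' [z [Az [Vz xz]]]; apply: Pe; exists z; split=> //; split=> //.
  exact: sub_box xz.
- have [Ax|NAx] := pselect (A x); first by exists 1.
  have [e e0 He] := member_separation (GF _ GA) NAx.
  by exists e => // -[z [Az [_ /He]]].
- exists e => // A GA AV; apply: (He) => //; split=> //.
  by have [z [Az [Vz _]]] := AV; exists z.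
Qed.

Definition crowded := [set x | forall e, 0 < e ->
  infinite_set (touching F (box x e))].

Lemma not_crowded x : ~ crowded x ->
  exists2 e, 0 < e & finite_set (touching F (box x e)).
Proof.
move=> Dx; apply: contrapT => Ne; apply: Dx => e e0 fe.
by apply: Ne; exists e.
Qed.


(** * Leaving a member of a minimal subcover *)
Definition line u y : set X := [set z | forall k, k != u -> co k z = co k y].

(** A private point y of C is kept out of each of the finitely many neighbours of
    C by one coordinate; these coordinates form s. *)
Lemma separating_coords G C y : G `<=` F -> G C ->
  (forall A, G A -> A y -> A = C) ->
  exists s : seq J, forall A, G A -> A `&` C !=set0 -> A <> C ->
    exists2 j, j \in s & rad A < `|co j (cen A) - co j y|.
Proof.
move=> GF GC priv.
have [||s Hs] := @finite_set_uniform_seq _ J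
    [set A | touching F C A /\ (G A /\ A <> C)]
    (fun A j => rad A < `|co j (cen A) - co j y|).
- by apply: sub_finite_set (touching_member (GF C GC)) => A [].
- move=> A [_ [GA neAC]]; apply: notin_member; first exact: GF.
  by move=> Ay; apply: neAC; exact: priv.
- by exists s => A GA neAC AneC; apply: Hs; split=> //; split=> //; exact: GF.
Qed.

(** Otherwise y can be moved along the coordinate u, inside the box, through the
    boundary of C at some w. The points just beyond w are covered by members of
    G; since only finitely many of these come close to w along the line, one of
    them contains w, so it is a neighbour of C. But a coordinate other than u
    excludes y, and with it the whole line, from that neighbour. *)
Lemma coordinate_unconstrained x0 h G C y (s : seq J) u :
  G `<=` F -> box x0 h `<=` \bigcup_(A in G) A -> G C ->
  box x0 h y -> C y ->
  (forall A, G A -> A `&` C !=set0 -> A <> C ->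
    exists2 j, j \in s & rad A < `|co j (cen A) - co j y|) ->
  u \notin s ->
  (forall w, box x0 h w -> C w -> line u y w -> exists2 e, 0 < e &
    finite_set (touching G (line u y `&` box x0 h `&` box w e))) ->
  forall v, `|co u x0 - v| <= h -> `|co u (cen C) - v| <= rad C.
Proof.
move=> GF GU GC Uy Cy sep us fin v xv; rewrite leNgt; apply/negP => Cv.
have FC := GF C GC.
have [w1 [Cw1 inw exitw]] := segment_exit ((mem_member y FC).1 Cy u) Cv.
have [w [wu wNu]] := update y u w1.
have Uw : box x0 h w.
  move=> k; have [->|ku] := eqVneq k u; last by rewrite wNu.
  by rewrite wu; apply: inw => //; exact: Uy.
have Cw : C w.
  apply/mem_member => // k; have [->|ku] := eqVneq k u; first by rewrite wu.
  by rewrite wNu//; move: k {ku}; apply/mem_member.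
have [e e0 efin] := fin w Uw Cw wNu.
have [e' e'0 He'] := touching_shrink w GF efin.
have [|w2 [w12 Cw2 inw2]] := exitw (Num.min e e'); first by rewrite lt_min e0.
have [z [zu zNu]] := update y u w2.
have Uz : box x0 h z.
  move=> k; have [->|ku] := eqVneq k u; last by rewrite zNu.
  by rewrite zu; apply: inw2 => //; exact: Uy.
have wz : box w (Num.min e e') z.
  move=> k; have [->|ku] := eqVneq k u; first by rewrite wu zu.
  by rewrite wNu// zNu// subrr normr0 le_min !ltW.
have [A GA Az] := GU z Uz.
have Aw : A w.
  apply: He' => //; exists z; split=> //; split; last first.
    by apply: sub_box wz; rewrite ge_min lexx orbT.
  by split=> //; apply: sub_box wz; rewrite ge_min lexx.
have neAC : A <> C.
  move=> neAC; move: Az; rewrite neAC => /(mem_member z FC)/(_ u).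
  by rewrite zu leNgt Cw2.
have [|j js] := sep A GA _ neAC; first by exists w.
have ju : j != u by apply: contraNneq us => <-.
rewrite -(zNu j ju) ltNge; apply/negP/negPn; move: j {js ju}.
by apply/mem_member => //; exact: GF.
Qed.

(** The finitely many separating coordinates leave some coordinate u free, and
    the u-interval of C then contains that of the box. *)
Lemma rad_ge_of_not_crowded x0 h G C :
  G `<=` F -> box x0 h `<=` \bigcup_(A in G) A -> G C ->
  (exists y, [/\ box x0 h y, C y & forall A, G A -> A y -> A = C]) ->
  (forall w, box x0 h w -> C w -> ~ crowded w) -> 0 < h ->
  h <= rad C.
Proof.
move=> GF GU GC [y [Uy Cy priv]] NC h0.
have [s sep] := separating_coords GF GC priv.
have [u us] := exists_fresh s.
have free := coordinate_unconstrained GF GU GC Uy Cy sep us.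
have {}free : forall v, `|co u x0 - v| <= h -> `|co u (cen C) - v| <= rad C.
  apply: free => w Uw Cw _; have [e e0 efin] := not_crowded (NC w Uw Cw).
  exists e => //; apply: sub_finite_set efin.
  by apply: touching_sub => // z [].
have /free : `|co u x0 - (co u x0 + h)| <= h.
  by rewrite ler_norml; apply/andP; split; lra.
have /free : `|co u x0 - (co u x0 - h)| <= h.
  by rewrite ler_norml; apply/andP; split; lra.
by rewrite !ler_norml => /andP[? ?] /andP[? ?]; lra.
Qed.

(** Induction on the number of free coordinates: an interval of radius at least
    h meeting one of radius h contains an end of it, so pushing the j-th
    coordinate to that end keeps the point in the member and removes j from the
    free coordinates. *)
Lemma touching_slab x0 h G (s : seq J) x :
  G `<=` F -> (forall A, G A -> h <= rad A) -> 0 < h ->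
  box x0 h x ->
  finite_set (touching G
    ([set z | forall k, k \notin s -> co k z = co k x] `&` box x0 h)).
Proof.
move=> GF Grad h0; elim: s x => [|j s IHs] x Ux.
  apply: sub_finite_set (point_finite x) => A [GA [z [Az [zx _]]]].
  split; first exact: GF.
  apply/mem_member => [|k]; first exact: GF.
  by rewrite -(zx k)//; move: k; apply/mem_member => //; exact: GF.
have [xp [xpj xpNj]] := update x j (co j x0 + h).
have [xm [xmj xmNj]] := update x j (co j x0 - h).
have Up : box x0 h xp.
  move=> k; have [->|kj] := eqVneq k j; last by rewrite xpNj.
  by rewrite xpj ler_norml; apply/andP; split; lra.
have Um : box x0 h xm.
  move=> k; have [->|kj] := eqVneq k j; last by rewrite xmNj.
  by rewrite xmj ler_norml; apply/andP; split; lra.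
have fm := IHs _ Um; have fp := IHs _ Up.
apply: (@sub_finite_set _ _ (_ `|` _)); last first.
  by rewrite finite_setU; split; [exact: fm|exact: fp].
move=> A [GA [z [Az [zx Uz]]]].
have FA := GF _ GA; have := Grad _ GA => hA.
have Aj := (mem_member z FA).1 Az j; have Uj := Uz j.
have [zp [zpj zpNj]] := update z j (co j x0 + h).
have [zm [zmj zmNj]] := update z j (co j x0 - h).
have [Aend|Aend] : `|co j (cen A) - (co j x0 - h)| <= rad A \/
    `|co j (cen A) - (co j x0 + h)| <= rad A.
  rewrite !ler_norml; move: Aj Uj; rewrite !ler_norml => /andP[? ?] /andP[? ?].
  have [?|?] := leP (co j (cen A)) (co j x0).
    by left; apply/andP; split; lra.
  by right; apply/andP; split; lra.
- left; split=> //; exists zm; split; last split.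
  + apply/mem_member => // k; have [->|kj] := eqVneq k j; first by rewrite zmj.
    by rewrite zmNj//; move: k {kj}; apply/mem_member.
  + move=> k ks; have [->|kj] := eqVneq k j; first by rewrite zmj xmj.
    by rewrite zmNj// xmNj// zx// in_cons negb_or kj.
  + move=> k; have [->|kj] := eqVneq k j; first by rewrite zmj -xmj.
    by rewrite zmNj.
- right; split=> //; exists zp; split; last split.
  + apply/mem_member => // k; have [->|kj] := eqVneq k j; first by rewrite zpj.
    by rewrite zpNj//; move: k {kj}; apply/mem_member.
  + move=> k ks; have [->|kj] := eqVneq k j; first by rewrite zpj xpj.
    by rewrite zpNj// xpNj// zx// in_cons negb_or kj.
  + move=> k; have [->|kj] := eqVneq k j; first by rewrite zpj -xpj.
    by rewrite zpNj.
Qed.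

(** By finiteness in slabs every member of G depends, within the box, on finitely
    many coordinates only. Let s gather those of the finitely many members
    through x0. In the slab of direction s these members cover a neighbourhood of
    x0, and a point near x0 is in such a member as soon as its projection q to
    the slab is. A neighbourhood of x0 covered by finitely many members meets
    finitely many members of F only. *)
Lemma not_crowded_of_large x0 h G :
  G `<=` F -> box x0 h `<=` \bigcup_(A in G) A ->
  (forall C, G C ->
    exists y, [/\ box x0 h y, C y & forall A, G A -> A y -> A = C]) ->
  0 < h -> (forall C, G C -> h <= rad C) -> ~ crowded x0.
Proof.
move=> GF GU priv h0 Grad.
have /choice[sC sCP] : forall C, exists s : seq J, G C ->
    forall u, u \notin s -> forall v, `|co u x0 - v| <= h ->
      `|co u (cen C) - v| <= rad C.
  move=> C; have [GC|NGC] := pselect (G C); last by exists [::].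
  have [y [Uy Cy Cpriv]] := priv C GC.
  have [s sep] := separating_coords GF GC Cpriv.
  exists s => _ u us; apply: (coordinate_unconstrained GF GU GC Uy Cy sep us) => w _ _ _.
  exists 1 => //.
  apply: sub_finite_set (touching_slab [:: u] GF Grad h0 Uy).
  apply: touching_sub => // z [[yz Uz] _]; split=> // k.
  by rewrite inE; exact: yz.
have Kfin : finite_set [set A | G A /\ A x0].
  by apply: sub_finite_set (point_finite x0) => A [/GF].
have /finite_seqP[l lE] := Kfin.
pose s := flatten [seq sC C | C <- l].
have sP C u : G C -> C x0 -> u \notin s -> u \notin sC C.
  move=> GC Cx0; apply: contraNN => usC; apply/flatten_mapP; exists C => //.
  suff : [set` l] C by [].
  by rewrite -lE.
have Ux0 : box x0 h x0 by apply: box_center; exact: ltW.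
have [e e0 He] := touching_shrink x0 GF
  (touching_slab s GF Grad h0 Ux0).
have cover p : box x0 (Num.min e h) p -> exists2 C, G C /\ C x0 & C p.
  move=> xp; have Up : box x0 h p by apply: sub_box xp; rewrite ge_min lexx orbT.
  have [q [qs qNs]] := patch s x0 p.
  have xq : box x0 (Num.min e h) q.
    move=> k; have [ks|ks] := boolP (k \in s); first by rewrite qs.
    by rewrite qNs// subrr normr0 le_min !ltW.
  have Uq : box x0 h q by apply: sub_box xq; rewrite ge_min lexx orbT.
  have [C GC Cq] := GU q Uq.
  have Cx0 : C x0.
    apply: He => //; exists q; split=> //; split=> //.
    by apply: sub_box xq; rewrite ge_min lexx.
  exists C => //; apply/mem_member => [|k]; first exact: GF.
  have [ks|ks] := boolP (k \in s).
    by rewrite -qs//; move: k {ks}; apply/mem_member => //; exact: GF.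
  by apply: (sCP C GC) => //; exact: sP.
move=> /(_ (Num.min e h)); apply; first by rewrite lt_min e0.
apply: (@sub_finite_set _ _
  (\bigcup_(C in [set A | G A /\ A x0]) touching F C)); last first.
  by apply: bigcup_finite => // C [GC _]; apply: touching_member; exact: GF.
move=> A [FA [p [Ap xp]]]; have [C [GC Cx0] Cp] := cover p xp.
by exists C => //; split=> //; exists p.
Qed.

Lemma minimal_subcover_box V : exists G, [/\ G `<=` F,
  V `<=` \bigcup_(A in G) A &
  forall C, G C -> exists y, [/\ V y, C y & forall A, G A -> A y -> A = C]].
Proof.
apply: minimal_subcover => [x|x _]; first exact: point_finite.
by have [A FA Ax] := F_cover x; exists A.
Qed.

(** The box is first made smaller than the finitely many members meeting B. The
    members disjoint from B contain no crowded point of the box, which bounds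
    their radii as well. *)
Lemma crowded_not_in_member x0 h B : crowded x0 -> 0 < h -> F B ->
  exists x, [/\ crowded x, box x0 h x & ~ B x].
Proof.
move=> Dx0 h0 FB; apply: contrapT => NB.
have {}NB x : crowded x -> box x0 h x -> B x.
  by move=> Dx Ux; apply: contrapT => Bx; apply: NB; exists x.
have [A e e' eA e'e|A [FA _]|e e0 He] := finite_set_uniform_radius
    (P := fun A e => e <= rad A) (touching_member FB).
- exact: le_trans eA.
- by exists (rad A) => //; exact: rad_gt0.
have m0 : 0 < Num.min e h by rewrite lt_min e0.
have [G [GF GU priv]] := minimal_subcover_box (box x0 (Num.min e h)).
apply: (not_crowded_of_large GF GU priv m0 _ Dx0) => C GC.
have [BC|BC] := pselect (C `&` B !=set0).
  apply: (@le_trans _ _ e); first by rewrite ge_min lexx.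
  by apply: He; split=> //; exact: GF.
apply: (rad_ge_of_not_crowded GF GU GC (priv C GC)) => // w Uw Cw Dw.
apply: BC; exists w; split=> //; apply: NB => //.
by apply: sub_box Uw; rewrite ge_min lexx orbT.
Qed.

(** Without crowded points, members of a minimal subcover of a box are at least
    as large as the box; but the finitely many members through the center have
    bounded radii, so a box of larger radius gives a contradiction. *)
Lemma crowded_nonempty : crowded !=set0.
Proof.
apply: contrapT => ND.
have [A e e' eA e'e|A [FA _]|e e0 He] := finite_set_uniform_radius
    (P := fun A e => e <= (rad A)^-1) (point_finite 0).
- exact: le_trans eA.
- by exists (rad A)^-1 => //; rewrite invr_gt0 rad_gt0.
(* e^-1 bounds the radii of the members through the origin. *)
have h0 : 0 < e^-1 + 1 by rewrite addr_gt0// invr_gt0.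
have [G [GF GU priv]] := minimal_subcover_box (box 0 (e^-1 + 1)).
have [C GC C0] := GU 0 (box_center _ (ltW h0)).
have : e^-1 + 1 <= rad C.
  apply: (rad_ge_of_not_crowded GF GU GC (priv C GC)) => // w _ _ Dw.
  by apply: ND; exists w.
have rC := rad_gt0 (GF C GC).
apply/negP; rewrite -ltNge ltr_pwDr// -(invrK (rad C)) lef_pV2 ?posrE ?invr_gt0//.
by apply: He; split=> //; exact: GF.
Qed.

Lemma sub_box_trans c d r s : box c r d -> box d s `<=` box c (r + s).
Proof. by move=> cd x dx j; rewrite (le_trans (ler_distD (co j d) _ _))// lerD. Qed.

(** One step of the Baire argument on the set of crowded points: shrink a box
    around a crowded point so as to avoid B. *)
Lemma shrink_to_crowded B x h d : crowded x -> 0 < h -> 0 < d ->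
  exists y e, [/\ crowded y, 0 < e, e <= d, box y e `<=` box x h &
    F B -> forall z, box y e z -> ~ B z].
Proof.
move=> Dx h0 d0.
have h20 : 0 < h / 2 by rewrite divr_gt0.
have [y [Dy xy By]] : exists y, [/\ crowded y, box x (h / 2) y & F B -> ~ B y].
  have [FB|NFB] := pselect (F B).
    by have [y [Dy xy NBy]] := crowded_not_in_member Dx h20 FB; exists y.
  by exists x; split=> //; exact/box_center/ltW.
have [e e0 He] : exists2 e, 0 < e & F B -> forall z, box y e z -> ~ B z.
  have [FB|NFB] := pselect (F B); last by exists 1.
  by have [e e0 He] := member_separation FB (By FB); exists e.
exists y, (Num.min (Num.min e d) (h / 2)); split=> //.
- by rewrite !lt_min e0 d0.
- by rewrite !ge_min lexx orbT.
- apply: subset_trans (sub_box_trans xy) _ => //; apply: sub_box.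
  by rewrite [leRHS]splitr lerD2l ge_min lexx orbT.
- move=> FB z yz; apply: He => //; apply: sub_box yz.
  by rewrite !ge_min lexx.
Qed.

(** Nested boxes around crowded points, chosen so that each member of F is
    avoided by one of them, shrink to a point that no member contains. *)
Lemma no_countable_star_finite_cover : False.
Proof.
have [x0 Dx0] := crowded_nonempty.
have [f Ff] : exists f : nat -> set X, forall A, F A -> exists n, f n = A.
  have /countable_injP[g ginj] := F_countable.
  (* Off the values taken by g on F, the value of f is arbitrary. *)
  have /choice[f fP] : forall n, exists A, (exists2 A', F A' & g A' = n) ->
      F A /\ g A = n.
    move=> n; have [[A FA gA]|N] := pselect (exists2 A', F A' & g A' = n).
      by exists A.
    by exists set0.
  exists f => A FA; exists (g A).
  have [|FfA gfA] := fP (g A); first by exists A.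
  by apply: ginj => //; apply/mem_set.
pose ball_of := {p : X * R | crowded p.1 /\ 0 < p.2}.
have step (p : nat * ball_of) : {q : nat * ball_of |
    [/\ q.1 = p.1.+1, (sval q.2).2 <= p.1.+1%:R^-1,
      box (sval q.2).1 (sval q.2).2 `<=` box (sval p.2).1 (sval p.2).2 &
      F (f p.1) -> forall z, box (sval q.2).1 (sval q.2).2 z -> ~ f p.1 z]}.
  case: p => n [[x h] /= [Dx h0]]; apply: cid.
  have d0 : 0 < n.+1%:R^-1 :> R by rewrite invr_gt0.
  have [y [e [Dy e0 ed sub av]]] := shrink_to_crowded (f n) Dx h0 d0.
  by exists (n.+1, exist _ (y, e) (conj Dy e0)).
have init : crowded (x0, 1 : R).1 /\ 0 < (x0, 1 : R).2 by split.
have [p [p0 pS]] := dependent_choice step (0%N, exist _ (x0, 1) init).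
have p1 n : (p n).1 = n.
  by elim: n => [|n IHn]; [rewrite p0|have [->] := pS n; rewrite IHn].
pose x n := (sval (p n).2).1; pose h n := (sval (p n).2).2.
have h0 n : 0 < h n by have [] := svalP (p n).2.
have hS n : h n.+1 <= n.+1%:R^-1 by have [_ + _ _] := pS n; rewrite p1.
have nested m n : (m <= n)%N -> box (x n) (h n) `<=` box (x m) (h m).
  elim: n => [|n IHn]; first by rewrite leqn0 => /eqP ->.
  rewrite leq_eqVlt => /predU1P[->//|/IHn]; apply: subset_trans.
  by have [] := pS n.
have xin m n : (m <= n)%N -> box (x m) (h m) (x n).
  by move=> mn; apply: nested mn _ _; exact/box_center/ltW.
have : cvg (x @ \oo).
  apply: cauchy_cvg; apply: cauchy_exP => e e0.
  have [N _ /(_ _ (leqnn N)) Ne] := near_infty_natSinv_lt (PosNum e0).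
  exists (x N.+1); exists N.+1 => // n /= Nn.
  rewrite -ball_normE /=; apply: le_lt_trans Ne; apply: le_trans (hS N).
  by apply/norm_co; [exact: ltW|exact: xin].
move=> /cvg_ex[/= l xl].
have inl m : box (x m) (h m) l.
  apply/norm_co; first exact: ltW.
  apply: (closed_cvg (closed_ball_ Num.norm (x m) (h m))
    (@closed_closed_ball_ _ _ (x m) (h m)) _ l xl).
  by exists m => // n /= mn; apply/norm_co; [exact: ltW|exact: xin].
have [A FA Al] := F_cover l.
have [n fn] := Ff A FA.
by have [_ _ _] := pS n; rewrite p1 fn => /(_ FA l (inl n.+1)).
Qed.
End BoxSpace.

Arguments box {R X J} co c r.

(** The previous result applied to balls: each member of the covering is given a
    center and a radius by choice. *)
Lemma sup_coordinates_no_cover (R : realType) (X : completeNormedModType R)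
    (J : choiceType) (co : J -> X -> R) :
  (forall x y (e : R), 0 <= e ->
    (`|x - y| <= e <-> forall j, `|co j x - co j y| <= e)) ->
  (forall x j (v : R), exists y,
    co j y = v /\ forall k, k != j -> co k y = co k x) ->
  infinite_set [set: J] ->
  ~ has_countable_star_finite_ball_covering X.
Proof.
move=> norm_co update J_infinite [F [Fcount [_ Fcov] Fstar Fball]].
have /choice[cr crP] : forall A, exists cr : X * R, F A ->
    0 < cr.2 /\ A = box co cr.1 cr.2.
  move=> A; have [FA|NFA] := pselect (F A); last by exists (0, 0).
  have [c [r [r0 ->]]] := Fball A FA.
  by exists (c, r); rewrite (boxE norm_co).
apply: (@no_countable_star_finite_cover R X J co norm_co update J_infinite F
  (fun A => (cr A).1) (fun A => (cr A).2)) => //.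
- by move=> A /crP[].
- by move=> A /crP[].
- by move=> x; have : [set: X] x by []; rewrite -Fcov => -[A FA Ax]; exists A.
Qed.

(** * Subspaces of bounded functions *)
Section FunctionSpaces.
Context {R : realType} {T : Type} {E : supSubspace R T}.

(** The evaluations at the points ev j are coordinates in the above sense when
    they determine the norm and the indicator of each point ev j belongs to the
    space; adding a multiple of that indicator changes one coordinate. *)
Lemma sup_subspace_no_cover (J : choiceType) (ev : J -> T) :
  injective ev -> infinite_set [set: J] ->
  (forall j, ss_set E (fun t => (`[< t = ev j >])%:R)) ->
  (forall f (e : R), ss_set E f -> (forall j, `|f (ev j)| <= e) ->
    forall t, `|f t| <= e) ->
  ~ has_countable_star_finite_ball_covering E.
Proof.
move=> evI Jinf ind dom.
apply: (@sup_coordinates_no_cover R _ J (fun j (f : E) => f (ev j))) => //.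
- move=> f g e e0; split=> [fg j|fg].
    by apply: le_trans fg; exact: (le_sup_norm (f - g)).
  apply: sup_norm_le => // t; apply: dom; first exact: ss_fun_in.
  exact: fg.
- move=> f j v.
  have dE : (fun t => (`[< t = ev j >])%:R) \in ss_pred E.
    by rewrite unfold_in /ss_pred inE; exact: ind.
  pose g : E := f + (v - f (ev j)) *: SSFun dE.
  have gE t : g t = f t + (v - f (ev j)) * (`[< t = ev j >])%:R by [].
  exists g; split=> [|k kj]; rewrite gE.
    by rewrite asboolT// mulr1 addrC subrK.
  by rewrite asboolF ?mulr0 ?addr0// => /evI kj'; rewrite kj' eqxx in kj.
Qed.
End FunctionSpaces.

Lemma infinite_set_type (I : Type) (A : set I) :
  infinite_set A -> infinite_set [set: set_type A].
Proof.
apply: contra_not => fin; apply: sub_finite_set (finite_image val fin) => i Ai.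
by exists (exist _ i (mem_set Ai)).
Qed.

(** * Isolated points *)
Section IsolatedPoints.
Context {T : topologicalType}.
Context (T_hausdorff : hausdorff_space T).
Context (T_infinite : infinite_set [set: T]).
Context (T_isolated_dense : dense (isolated [set: T])).

(** A finite set is closed in a Hausdorff space, and a closed dense set is the
    whole space. *)
Lemma infinite_isolated : infinite_set (isolated [set: T]).
Proof.
move=> fin; apply: T_infinite; apply: sub_finite_set (fin) => t _.
apply: contrapT => Nt.
have [||x []//] := @T_isolated_dense (~` isolated [set: T]).
  by exists t.
apply: closed_openC; apply: accessible_finite_set_closed.1 => //.
exact: hausdorff_accessible.
Qed.

Lemma isolated_nbhs (t : T) : isolated [set: T] t -> nbhs t [set t].
Proof. by move=> [_ [V tV]]; rewrite setIT => <-. Qed.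

Lemma continuous_indicator (R : realType) (t : T) : isolated [set: T] t ->
  continuous (fun s => (`[< s = t >])%:R : R).
Proof.
move=> it s.
have [->|/eqP st] := eqVneq s t.
  apply: cvg_near_cst; apply: filterS (isolated_nbhs it) => _ ->.
  by rewrite asboolT.
have tC : closed [set t].
  apply: accessible_closed_set1; exact: hausdorff_accessible.
apply: cvg_near_cst; apply: filterS (open_nbhs_nbhs (conj (closed_openC tC) st)).
by move=> r /= rt; rewrite !asboolF.
Qed.

Lemma dense_isolated_dominates (R : realType) (f : T -> R) (e : R) :
  continuous f -> (forall t : set_type (isolated [set: T]), `|f (val t)| <= e) ->
  forall t, `|f t| <= e.
Proof.
move=> cf fe t; rewrite leNgt; apply/negP => et.
have [||s [/= es is_]] := @T_isolated_dense ([set s | e < `|f s|]).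
- by exists t.
- apply: (@open_comp _ _ (fun s => `|f s|) [set x | e < x]); last exact: open_gt.
  by move=> s _; apply: cvg_norm; exact: cf.
- by move: es; apply/negP; rewrite -leNgt; exact: (fe (exist _ s (mem_set is_))).
Qed.
End IsolatedPoints.

Lemma indicator_bounded (R : realType) (I : Type) (i : I) :
  bounded_fun (fun t => (`[< t = i >])%:R : R).
Proof.
by apply/bounded_funPex; exists 1 => t; case: `[< _ >]; rewrite ?normr0 ?normr1.
Qed.

Lemma indicator_support (R : realType) (I : Type) (i : I) (e : R) : 0 < e ->
  [set t | e <= `|(`[< t = i >])%:R| ] `<=` [set i].
Proof.
by move=> e0 t /=; case: asboolP => // _; rewrite normr0 leNgt e0.
Qed.

(** * Spaces of continuous functions and sequence spaces *)
Theorem corollary3p15 (R : realType) (T : topologicalType) (Gamma : Type)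
    (T_hausdorff : hausdorff_space T)
    (T_infinite : infinite_set [set: T])
    (T_isolated_dense : dense (isolated [set: T]))
    (Gamma_infinite : infinite_set [set: Gamma]) :
  [/\ forall cT : compact [set: T],
        ~ has_countable_star_finite_ball_covering (C_space R cT),
      locally_compact [set: T] ->
        ~ has_countable_star_finite_ball_covering (C0_space R T),
      ~ has_countable_star_finite_ball_covering (linfty_space R Gamma) &
      ~ has_countable_star_finite_ball_covering (c0_space R Gamma)].
Proof.
have isoJ := infinite_set_type
  (infinite_isolated T_hausdorff T_infinite T_isolated_dense).
have isoP (t : set_type (isolated [set: T])) : isolated [set: T] (val t).
  exact: set_mem (valP t).
split=> [cT|_||].
- apply: (sup_subspace_no_cover (ev := val) val_inj isoJ) => [t|f e cf] /=.
    exact: continuous_indicator (isoP t).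
  exact: dense_isolated_dominates.
- apply: (sup_subspace_no_cover (ev := val) val_inj isoJ)
    => [t|f e [_ cf _]] /=.
    have cind := continuous_indicator (R := R) T_hausdorff (isoP t).
    split=> [||e e0]; [exact: indicator_bounded|exact: cind|].
    apply: subclosed_compact (compact_set1 (x := val t)) (indicator_support e0).
    exact: closed_norm_ge cind.
  exact: dense_isolated_dominates.
- apply: (sup_subspace_no_cover (J := {classic Gamma}) (ev := id)) => // [t] /=.
  exact: indicator_bounded.
- apply: (sup_subspace_no_cover (J := {classic Gamma}) (ev := id)) => // [t] /=.
  split=> [|e e0]; first exact: indicator_bounded.
  exact: sub_finite_set (indicator_support e0) (finite_set1 _).
Qed.
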